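(* Let $X$ be a first countable $\omega$-well-filtered $T_0$ space and let $A$ be an irreducible subset of $X$. Then the closure $\overline{A}$ is directed (with respect to the specialization order of $X$).
   Context: A subset of a space is saturated if it is an intersection of open sets. A family of sets is filtered if it is nonempty and any two members contain a third member of the family. A $T_0$ space $X$ is $\omega$-well-filtered if for every countable filtered family $\{K_i : i<\omega\}$ of nonempty compact saturated subsets of $X$ and every open $U\subseteq X$, $\bigcap_{i<\omega}K_i\subseteq U$ implies $K_{i_0}\subseteq U$ for some $i_0<\omega$. A nonempty set $A\subseteq X$ is irreducible if for all closed $F_1,F_2$, $A\subseteq F_1\cup F_2$ implies $A\subseteq F_1$ or $A\subseteq F_2$. The specialization order is $x\leq y$ iff $x\in\overline{\{y\}}$. A nonempty subset $D$ of a poset is directed if any two elements of $D$ have an upper bound in $D$. *)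

(* Defs.v *)
From mathcomp Require Import all_boot all_order.
From mathcomp Require Import boolp classical_sets functions cardinality filter.
From mathcomp Require Import topology.

Set Implicit Arguments.
Unset Strict Implicit.
Unset Printing Implicit Defensive.

Local Open Scope classical_set_scope.

Definition directed {T : Type} (R : T -> T -> Prop) (D : set T) : Prop :=
  D !=set0 /\ forall x y, D x -> D y -> exists z, [/\ D z, R x z & R y z].

Definition filtered {T : Type} (F : set (set T)) : Prop :=
  F !=set0 /\
  forall A B, F A -> F B -> exists C, [/\ F C, C `<=` A & C `<=` B].

Definition specialization {X : topologicalType} (x y : X) : Prop :=
  closure [set y] x.

(* The intersection of the empty family is the whole space. *)
Definition saturated {X : topologicalType} (A : set X) : Prop :=
  exists2 F : set (set X), F `<=` open & A = \bigcap_(U in F) U.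

Definition irreducible_set {X : topologicalType} (A : set X) : Prop :=
  A !=set0 /\
  forall F1 F2 : set X, closed F1 -> closed F2 ->
    A `<=` F1 `|` F2 -> A `<=` F1 \/ A `<=` F2.

Definition first_countable (X : topologicalType) : Prop :=
  forall x : X, exists B : set (set X),
    [/\ countable B,
        forall V, B V -> nbhs x V
      & forall U, nbhs x U -> exists2 V, B V & V `<=` U].

(* The separation axiom T0 is not included here. *)
Definition omega_well_filtered (X : topologicalType) : Prop :=
  forall K : nat -> set X,
    (forall i, [/\ K i !=set0, compact (K i) & saturated (K i)]) ->
    filtered (range K) ->
    forall U : set X, open U ->
      \bigcap_i K i `<=` U -> exists i0, K i0 `<=` U.

(* Main.v *)
Require Import Defs.
From mathcomp Require Import all_boot all_order.
From mathcomp Require Import boolp classical_sets functions cardinality filter.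
From mathcomp Require Import topology.

(** Let [x] and [y] be in the closure of the irreducible set [A].  Nonempty
open traces on [A] have the finite intersection property, so one can choose
points [a 0], [a 1], ... of [A] successively, each [a n] lying in a basic
neighbourhood, of index growing with [n], of [x], of [y] and of every earlier
point.  The resulting
sequence converges to [x], to [y] and to each of its own terms
([irreducible_cvg_seq]).

Convergence to its own terms is what makes the upper closure of every tail of
the sequence compact ([compact_upset_range]): a neighbourhood of the first
point of a tail misses only finitely many of its points, and the upper closure
of one point is always compact.  These upper closures form a decreasing
sequence of compact saturated sets, none of which lies in the complement of
the closure of [A] because they all contain points of [A].  By
omega-well-filteredness some [z] in the closure of [A] belongs to all of them.
Such a [z] lies above terms [a k] with [k] arbitrarily large, hence belongs to
every neighbourhood of every limit of the sequence; so [z] is an upper bound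
of [x] and [y]. *)

Set Implicit Arguments.
Unset Strict Implicit.
Unset Printing Implicit Defensive.

Local Open Scope classical_set_scope.

Definition upset {X : topologicalType} (S : set X) : set X :=
  [set z | exists2 s, S s & specialization s z].

Section Upset.
Context {X : topologicalType}.
Implicit Types (x y z : X) (S K U : set X).

Lemma specialization_nbhs x y U : specialization x y -> nbhs x U -> U y.
Proof. by move=> xy /xy[_ [->]]. Qed.

Lemma sub_upset S : S `<=` upset S.
Proof. by move=> s Ss; exists s => //; apply: subset_closure. Qed.

Lemma upsetS S T : S `<=` T -> upset S `<=` upset T.
Proof. by move=> ST z [s /ST Ts sz]; exists s. Qed.

Lemma upset_nbhs S U z : (forall s, S s -> nbhs s U) -> upset S z -> U z.
Proof. by move=> SU [s /SU sU /specialization_nbhs]; apply. Qed.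

(** A point [z] outside the upper closure of [S] is excluded by the open set
[~` closure [set z]], which contains [S]. *)
Lemma saturated_upset S : saturated (upset S).
Proof.
exists [set U | open U /\ S `<=` U]; first by move=> U [].
apply/seteqP; split=> [z Sz U [oU SU] | z Uz].
  by apply: upset_nbhs Sz => s /SU Us; apply: open_nbhs_nbhs.
apply: contrapT => nSz; have : (~` closure [set z]) z.
  apply: Uz; split; first by rewrite openC; apply: closed_closure.
  by move=> s Ss sz; apply: nSz; exists s.
by apply; apply: subset_closure.
Qed.

(** The point [x] is a cluster point of every filter containing its upper
closure, since each neighbourhood of [x] contains that closure. *)
Lemma compact_upset1 x : compact (upset [set x]).
Proof.
move=> F FF Fx; exists x; split; first exact: sub_upset.
move=> V U FV xU; have [z [xz Vz]] := filter_ex (filterI Fx FV).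
by exists z; split=> //; apply: upset_nbhs xz => _ ->.
Qed.

(** If a filter containing [K] does not cluster at [x], some neighbourhood of
[x] misses a member of the filter; the filter then contains the compact set
[L] that accounts for the rest of [K], and clusters there. *)
Lemma compact_nbhs_cover K x :
  K x ->
  (forall U, nbhs x U -> exists L, [/\ compact L, L `<=` K & K `<=` U `|` L]) ->
  compact K.
Proof.
move=> Kx coK F FF FK.
have [Fx|] := pselect (cluster F x); first by exists x.
move=> /existsNP[V] /existsNP[U] /not_implyP[FV] /not_implyP[xU VU0].
have [L [cL LK KUL]] := coK U xU.
have FL : F L.
  apply: filterS (filterI FK FV) => z [/KUL[Uz|//] Vz].
  by case: VU0; exists z.
by have [z [/LK Kz Fz]] := cL F FF FL; exists z.
Qed.

(** A neighbourhood of [b 0] contains the upper closures of all but finitely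
many terms, and the upper closures of the others have a compact union. *)
Lemma compact_upset_range (b : nat -> X) :
  b @ \oo --> b 0 -> compact (upset (range b)).
Proof.
move=> bb; apply: (@compact_nbhs_cover _ (b 0)).
  by apply: sub_upset; exists 0.
move=> U /nbhs_interior/bb[N _ bU].
exists (\bigcup_(k < N) upset [set b k]); split.
- rewrite bigcup_mkord; apply: bigsetU_compact => i _; exact: compact_upset1.
- by move=> z [k _]; apply: upsetS => _ ->; exists k.
- move=> z [_ [k _ <-] kz]; have [kN|Nk] := ltnP k N.
    by right; exists k => //; exists (b k).
  by left; apply: specialization_nbhs kz (bU k Nk).
Qed.

End Upset.

Section ConvergentSequence.
Context {X : topologicalType}.
Implicit Types (x y z : X) (A U : set X).

(** The bases are decreasing so that a sequence whose [n]-th term is in the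
[n]-th basic neighbourhood of a point converges to that point; finite intersections of the sets of an arbitrary
countable base provide them. *)
Lemma first_countable_base :
  first_countable X -> exists B : X -> nat -> set X,
    [/\ forall x n, open (B x n), forall x n, B x n x,
        forall x m n, (m <= n)%N -> B x n `<=` B x m
      & forall x U, nbhs x U -> exists n, B x n `<=` U].
Proof.
move=> fcX; suff /choice[B BP] : forall x, exists B : nat -> set X,
    [/\ forall n, open (B n), forall n, B n x,
        forall m n, (m <= n)%N -> B n `<=` B m
      & forall U, nbhs x U -> exists n, B n `<=` U].
  by exists B; split=> x; case: (BP x).
move=> x; have [B [cB Bx xB]] := fcX x.
have [V0 BV0 _] := xB setT filterT.
have [B0|[g]] := pfcard_geP cB; first by rewrite B0 in BV0.
exists (fun n => \bigcap_(i < n) (g i)°); split.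
- move=> n; rewrite bigcap_mkord; elim/big_ind: _ => //; first exact: openT.
  + exact: openI.
  + by move=> i _; apply: open_interior.
- by move=> n i _; apply: nbhs_singleton; apply/nbhs_interior/Bx; exact: funS.
- by move=> m n mn z Bz i im; apply: Bz; apply: leq_trans im mn.
- move=> U /xB[V BV VU]; have [i _ giV] := @surj _ _ _ _ g _ BV.
  by exists i.+1 => z /(_ i (ltnSn i))/interior_subset; rewrite giV => /VU.
Qed.

(** This is the definition of irreducibility read on complements. *)
Lemma irreducible_meetI A U V : irreducible_set A -> open U -> open V ->
  A `&` U !=set0 -> A `&` V !=set0 -> A `&` (U `&` V) !=set0.
Proof.
move=> [_ irrA] oU oV [u [Au Uu]] [v [Av Vv]]; apply: contrapT => AUV.
have [|||AsubU|AsubV] := irrA (~` U) (~` V); rewrite ?closedC//.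
- move=> a Aa; rewrite -setCI => UVa; by apply: AUV; exists a.
- exact: AsubU Au Uu.
- exact: AsubV Av Vv.
Qed.

Lemma irreducible_meet_seq A (W : X -> set X) (s : seq X) :
  irreducible_set A ->
  (forall p, p \in s -> closure A p /\ open_nbhs p (W p)) ->
  exists2 a, A a & forall p, p \in s -> W p a.
Proof.
move=> irrA sW; suff [_ [a [Aa Wa]]] :
    open (\bigcap_(p in [set` s]) W p) /\
    A `&` \bigcap_(p in [set` s]) W p !=set0.
  by exists a.
rewrite bigcap_seq big_seq; elim/big_ind: _.
- by split; [exact: openT | rewrite setIT; case: irrA].
- move=> U V [oU AU] [oV AV]; split; first exact: openI.
  exact: irreducible_meetI.
- by move=> p /sW[Ap [oW Wp]]; split=> //; apply: Ap; apply: open_nbhs_nbhs.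
Qed.

(** The terms are produced by a recursion on the list of points to converge
to, which starts from [s] and receives each new term of the sequence. *)
Lemma irreducible_cvg_seq A (s : seq X) :
  first_countable X -> irreducible_set A ->
  (forall p, p \in s -> closure A p) ->
  exists a : nat -> X, [/\ forall n, A (a n), forall n, a @ \oo --> a n
    & forall p, p \in s -> a @ \oo --> p].
Proof.
move=> /first_countable_base[B [oB Bx Bmono Bbase]] irrA sA.
have /choice[f fP] : forall t : seq X, exists a,
    (forall p, p \in t -> closure A p) ->
    A a /\ forall p, p \in t -> B p (size t) a.
  move=> t; have [tA|/existsNP[p ntA]] :=
    pselect (forall p, p \in t -> closure A p); last first.
    by exists p => tA; case: ntA => pt; apply: tA.
  have [|a Aa Wa] := @irreducible_meet_seq A (fun p => B p (size t)) t irrA.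
    by move=> p pt; split; [exact: tA | split].
  by exists a.
pose t n := iter n (fun u => f u :: u) s.
have tA n : forall p, p \in t n -> closure A p.
  elim: n => // n IHn p; rewrite inE => /predU1P[->|/IHn//].
  by apply: subset_closure; case: (fP _ IHn).
have size_t n : (n <= size (t n))%N by elim: n.
have tS m n p : (m <= n)%N -> p \in t m -> p \in t n.
  move=> /subnK <-; elim: (n - m)%N => // k IHk /IHk pt.
  by rewrite addSn inE pt orbT.
have t_cvg m p : p \in t m -> (fun n => f (t n)) @ \oo --> p.
  move=> pt U /Bbase[N BU]; exists (maxn m N) => // n /=.
  rewrite geq_max => /andP[mn Nn]; apply: BU.
  apply: Bmono (leq_trans Nn (size_t n)) _ _.
  by case: (fP _ (tA n)) => _; apply; apply: tS pt.
exists (fun n => f (t n)); split=> [n|n|p ps].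
- by case: (fP _ (tA n)).
- by apply: (t_cvg n.+1); rewrite inE eqxx.
- exact: (t_cvg 0).
Qed.

End ConvergentSequence.

Theorem theorem4p1 (X : topologicalType) (A : set X) :
  kolmogorov_space X ->
  first_countable X ->
  omega_well_filtered X ->
  irreducible_set A ->
  directed (@specialization X) (closure A).
Proof.
move=> _ fcX wfX irrA; split.
  by case: irrA => -[a Aa] _; exists a; apply: subset_closure.
move=> x y Ax Ay.
have [|a [Aa aa axy]] := @irreducible_cvg_seq X A [:: x; y] fcX irrA.
  by move=> p; rewrite !inE => /orP[]/eqP->.
pose K n := upset (range (fun k => a (k + n))).
have Ka n : K n (a n) by apply: sub_upset; exists 0.
have Kmono m n : (m <= n)%N -> K n `<=` K m.
  move=> mn; apply: upsetS => _ [k _ <-]; exists (k + (n - m)) => //.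
  by rewrite -addnA subnK.
have [z Kz Az] : exists2 z, (\bigcap_i K i) z & closure A z.
  apply: contrapT => noz; have [|||i|i KA] := wfX K _ _ (~` closure A).
  - move=> i; split; [by exists (a i) | | exact: saturated_upset].
    apply: compact_upset_range; rewrite add0n => U /aa[N _ aU].
    by exists N => // k /= Nk; apply: aU; apply: leq_trans Nk (leq_addr _ _).
  - split; first by exists (K 0), 0.
    move=> _ _ [m _ <-] [n _ <-]; exists (K (maxn m n)).
    by split; [exists (maxn m n) | exact: Kmono (leq_maxl _ _)
             | exact: Kmono (leq_maxr _ _)].
  - by rewrite openC; apply: closed_closure.
  - by move=> Kz Az; apply: noz; exists i.
  - by apply: (KA _ (Ka i)); apply: subset_closure.
(* Every tail has a term below z, and late terms lie in U. *)
have z_above p : a @ \oo --> p -> specialization p z.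
  move=> ap U /nbhs_interior/ap[N _ aU]; exists z; split=> //.
  apply: upset_nbhs (Kz N I) => _ [k _ <-].
  by apply: aU; apply: leq_addl.
by exists z; split=> //; apply: z_above; apply: axy; rewrite !inE eqxx ?orbT.
Qed.
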